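(* Let $H$ be a pointed Hopf algebra over a field $\mathbb{K}$ with invertible antipode and finite group $G=G(H)$ of grouplike elements. Let $A$ be a symmetric partial left $H$-module algebra. Given $X\in\mathcal{P}_1(G)$, the element $$\Gamma^A_X=\frac{1}{|G_X|}\sum_{g\in G}g\cdot P^A_X=\frac{1}{|G_X|}\sum_{g^{-1}\in X}P^A_{gX}$$ is a central idempotent element of $A$, and satisfies $$h\cdot\Gamma^A_X=(h\cdot 1_A)\Gamma^A_X\quad\text{for all }h\in H.$$
   Context: Sweedler notation $\Delta(h)=h_{1}\otimes h_{2}$ is used. A Hopf algebra is pointed if all its simple subcoalgebras are one-dimensional. A symmetric partial left $H$-module algebra is a unital algebra $A$ with a linear map $H\otimes A\to A$, $h\otimes a\mapsto h\cdot a$, such that for all $h,k\in H$, $a,b\in A$: $1_H\cdot a=a$; $h\cdot(ab)=(h_1\cdot a)(h_2\cdot b)$; $h\cdot(k\cdot a)=(h_1\cdot 1_A)(h_2k\cdot a)$; and $h\cdot(k\cdot a)=(h_1k\cdot a)(h_2\cdot 1_A)$. $\mathcal{P}_1(G)=\{X\subseteq G\mid 1_H\in X\}$. For $X\in\mathcal{P}_1(G)$, $$P^A_X=\prod_{x\in X}(x\cdot 1_A)\prod_{y\in G\setminus X}(1_A-(y\cdot 1_A))$$ (each $g\cdot 1_A$, $g\in G$, is a central idempotent of $A$). For $X\in\mathcal{P}_1(G)$, $G_X=\{g\in G\mid g^{-1}\in X,\ gX=X\}$ is the stabilizer of $X$, a subgroup of $G$. The second sum runs over all $g\in G$ with $g^{-1}\in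 X$. *)

(* Defs.v *)
From HB Require Import structures.
From mathcomp Require Import all_boot all_order all_algebra all_fingroup.

Set Implicit Arguments.
Unset Strict Implicit.
Unset Printing Implicit Defensive.

Import GRing.Theory.
Local Open Scope ring_scope.

(* Elements of U (x) V are represented by finite formal sums of pure tensors,
   i.e. by lists of pairs. Two lists denote the same tensor iff no bilinear map
   separates them (universal property of the tensor product); likewise for
   threefold tensor products, with trilinear maps. *)
Definition tens_eq (K : fieldType) (U V : lmodType K) (s t : seq (U * V)) :
    Prop :=
  forall (W : lmodType K) (f : {bilinear U -> V -> W}),
    \sum_(p <- s) f p.1 p.2 = \sum_(p <- t) f p.1 p.2.

Definition trilinear (K : fieldType) (U V T W : lmodType K)
    (f : U -> V -> T -> W) : Prop :=
  [/\ forall v t, linear (fun u => f u v t),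
      forall u t, linear (fun v => f u v t) &
      forall u v, linear (f u v)].

Definition tens3_eq (K : fieldType) (U V T : lmodType K)
    (s t : seq (U * V * T)) : Prop :=
  forall (W : lmodType K) (f : U -> V -> T -> W), trilinear f ->
    \sum_(p <- s) f p.1.1 p.1.2 p.2 = \sum_(p <- t) f p.1.1 p.1.2 p.2.

(* [comul h] is some representative of Delta(h) in C (x) C, so all laws are
   stated up to [tens_eq]. For F bilinear, Sweedler's F(h_1, h_2) is
   [\sum_(p <- comul h) F p.1 p.2]. *)
Record coalgebra (K : fieldType) (C : lmodType K) := Coalgebra {
  comul : C -> seq (C * C);
  counit : {scalar C};
  comul_linear : forall (k : K) (x y : C),
    tens_eq (comul (k *: x + y))
            ([seq (k *: p.1, p.2) | p <- comul x] ++ comul y);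
  comulA : forall x : C,
    tens3_eq [seq (q.1, q.2, p.2) | p <- comul x, q <- comul p.1]
             [seq (p.1, q.1, q.2) | p <- comul x, q <- comul p.2];
  comul_counitl : forall x : C, \sum_(p <- comul x) counit p.1 *: p.2 = x;
  comul_counitr : forall x : C, \sum_(p <- comul x) counit p.2 *: p.1 = x
}.

Record hopf_algebra (K : fieldType) (H : algType K) := HopfAlgebra {
  hopf_coalgebra :> coalgebra H;
  comul1 : tens_eq (comul hopf_coalgebra 1) [:: (1, 1)];
  comulM : forall x y : H,
    tens_eq (comul hopf_coalgebra (x * y))
            [seq (p.1 * q.1, p.2 * q.2) | p <- comul hopf_coalgebra x,
                                          q <- comul hopf_coalgebra y];
  counit1 : counit hopf_coalgebra 1 = 1;
  counitM : forall x y : H,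
    counit hopf_coalgebra (x * y)
    = counit hopf_coalgebra x * counit hopf_coalgebra y;
  antipode : {linear H -> H};
  antipodel : forall x : H,
    \sum_(p <- comul hopf_coalgebra x) antipode p.1 * p.2
    = counit hopf_coalgebra x *: 1;
  antipoder : forall x : H,
    \sum_(p <- comul hopf_coalgebra x) p.1 * antipode p.2
    = counit hopf_coalgebra x *: 1
}.

Section Pointed.

Variables (K : fieldType) (C : lmodType K) (cC : coalgebra C).

Definition subspace (D : C -> Prop) : Prop :=
  D 0 /\ forall (k : K) (x y : C), D x -> D y -> D (k *: x + y).

Definition subcoalgebra (D : C -> Prop) : Prop :=
  subspace D /\
  forall x, D x ->
    exists2 s : seq (C * C),
      forall p, p \in s -> D p.1 /\ D p.2 & tens_eq (comul cC x) s.

Definition simple_subcoalgebra (D : C -> Prop) : Prop :=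
  [/\ subcoalgebra D,
      exists2 x, D x & x != 0 &
      forall E : C -> Prop, subcoalgebra E -> (forall x, E x -> D x) ->
        (forall x, E x -> x = 0) \/ (forall x, D x -> E x)].

Definition one_dimensional (D : C -> Prop) : Prop :=
  exists2 d, d != 0 & forall x, D x <-> exists k : K, x = k *: d.

Definition pointed : Prop :=
  forall D, simple_subcoalgebra D -> one_dimensional D.

Definition grouplike (g : C) : Prop :=
  g != 0 /\ tens_eq (comul cC g) [:: (g, g)].

End Pointed.

(* [u] identifies the finite group [gT] with G(H); in particular G(H) is
   finite. *)
Record grouplike_group (K : fieldType) (H : algType K) (hH : hopf_algebra H)
    (gT : finGroupType) (u : gT -> H) : Prop := GrouplikeGroup {
  grouplike_inj : injective u;
  grouplike1 : u 1%g = 1;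
  grouplikeM : forall x y : gT, u (x * y)%g = u x * u y;
  grouplikeP : forall h : H, grouplike hH h <-> exists x : gT, u x = h
}.

Record partial_action (K : fieldType) (H : algType K) (hH : hopf_algebra H)
    (A : algType K) := PartialAction {
  pact :> {bilinear H -> A -> A};
  pact1 : forall a : A, pact 1 a = a;
  pactM : forall (h : H) (a b : A),
    pact h (a * b) = \sum_(p <- comul hH h) pact p.1 a * pact p.2 b;
  pact_pactl : forall (h k : H) (a : A),
    pact h (pact k a) = \sum_(p <- comul hH h) pact p.1 1 * pact (p.2 * k) a;
  pact_pactr : forall (h k : H) (a : A),
    pact h (pact k a) = \sum_(p <- comul hH h) pact (p.1 * k) a * pact p.2 1
}.

Section Gamma.

Variables (K : fieldType) (H : algType K) (hH : hopf_algebra H).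
Variables (A : algType K) (act : partial_action hH A).
Variables (gT : finGroupType) (u : gT -> H).

Implicit Type X : {set gT}.

Definition PX X : A :=
  \prod_(x in X) act (u x) 1 * \prod_(y in ~: X) (1 - act (u y) 1).

Definition GX X : {set gT} :=
  [set g : gT | (g^-1%g \in X) && ((g *: X)%g == X)].

Definition Gamma X : A := #|GX X|%:R^-1 *: \sum_(g : gT) act (u g) (PX X).

(* Each translate gX with g^-1 in X arises from exactly #|GX X| elements g, so
   dividing by #|GX X| amounts to counting each translate once. Unlike [Gamma],
   where the inverse is taken in K (and 0^-1 = 0), this expression is also
   meaningful when char K divides #|GX X|. *)
Definition GammaT X : A :=
  \sum_(Y in [set (g *: X)%g | g : gT & g^-1%g \in X]) PX Y.

Definition central_idempotent (e : A) : Prop :=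
  (forall a : A, e * a = a * e) /\ e * e = e.

End Gamma.

(* Main.v *)
Require Import Defs.
From HB Require Import structures.
From mathcomp Require Import all_boot all_order all_algebra all_fingroup.
From mathcomp Require Import boolp.
From mathcomp Require classical_sets.

Set Implicit Arguments.
Unset Strict Implicit.
Unset Printing Implicit Defensive.

Import GRing.Theory.
Local Open Scope ring_scope.

(** A central idempotent e of A is invariant, that is h.e = (h.1) e for every
    h in H, as soon as g.e = (g.1) e for the grouplike elements g; the rest is a
    computation with the finitely many central idempotents g.1.

    To pass from the group to H, consider the linear map d : H -> A,
    d(h) = h.e - (h.1) e. Expanding h.(ee), h.(e1), h.(1e) and h.(11) shows
    that d is a solution of the quadratic equation d * d = (1 - 2e) d in the
    convolution algebra Hom(H, A) [pact_invariant]; here 1 - 2e is invertible,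
    being an involution, and d kills the grouplike elements. Hence d is, up to
    a unit, equal to all of its convolution powers, and a map that kills the
    coradical of a pointed coalgebra has powers that vanish on any given
    element; so d = 0 [pointed_quadratic0].

    The nilpotency is proved without the coradical filtration, by means of
    multiplicative matrices: square matrices c over the coalgebra such that
    Delta(c_ij) is the sum of the c_ik (x) c_kj and counit(c_ij) is the
    Kronecker delta. They are the coefficient matrices of finite-dimensional
    comodules, and their entries cover the coalgebra [multiplicative_cover].
    If the comodule is irreducible, the span of the entries is a simple
    subcoalgebra [irreducible_simple], which is spanned by a grouplike element
    when the coalgebra is pointed. Otherwise c is conjugate to a block
    triangular matrix whose diagonal blocks are smaller multiplicative matrices
    [reducible_triangular]; by induction d kills both diagonal blocks, and then
    the equation (1 - 2e) d(c) = d(c) d(c) kills the corner block too.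

    For the group part, with 1 in X, one has g.P_X = P_{gX}, and P_Y = 0 unless
    1 is in Y, while the P_Y are pairwise orthogonal central idempotents. So the
    sum of the distinct P_{gX} runs over a full orbit of the translation action
    of G on subsets, which makes it an invariant central idempotent
    [GammaT_central_idempotent, GammaT_group_invariant], and each of its terms
    is repeated #|GX X| times in the sum over g [GammaT_mulrn]. The normalised
    element Gamma is then either this idempotent or 0, according to whether
    #|GX X| is nonzero in K. *)

(** * Linear functionals and tensors *)

Section Tensors.

Variable K : fieldType.

Lemma tens_eq_sum (U V W : lmodType K) (F : U -> V -> W) (s t : seq (U * V)) :
    (forall v, linear (F^~ v)) -> (forall u, linear (F u)) -> tens_eq s t ->
  \sum_(p <- s) F p.1 p.2 = \sum_(p <- t) F p.1 p.2.
Proof.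
move=> Fl Fr st.
pose B : {bilinear U -> V -> W} :=
  HB.pack F (bilinear_isBilinear.Build K U V W *:%R *:%R F (Fl, Fr)).
exact: (st W B).
Qed.

Lemma subspaceZ (V : lmodType K) (D : V -> Prop) k y :
  subspace D -> D y -> D (k *: y).
Proof. by case=> D0 DP Dy; rewrite -[k *: y]addr0; apply: DP. Qed.

Lemma subspaceD (V : lmodType K) (D : V -> Prop) y z :
  subspace D -> D y -> D z -> D (y + z).
Proof. by case=> D0 DP Dy Dz; rewrite -[y]scale1r; apply: DP. Qed.

Lemma subspaceB (V : lmodType K) (D : V -> Prop) y z :
  subspace D -> D y -> D z -> D (y - z).
Proof. by case=> D0 DP Dy Dz; rewrite addrC -scaleN1r; apply: DP. Qed.

Lemma subspace_sum (V : lmodType K) (D : V -> Prop) (I : finType) (v : I -> V) :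
  subspace D -> (forall i, D (v i)) -> D (\sum_i v i).
Proof.
by move=> Ds Dv; apply: big_ind => //; [exact: Ds.1 | move=> *; exact: subspaceD].
Qed.

(** By Zorn's lemma. The maximal N containing D and missing x is a hyperplane
    complementary to the line K x, since x would lie in N + K y for any y
    outside N. *)
Lemma maximal_subspace_avoiding (V : lmodType K) (D : V -> Prop) (x : V) :
    subspace D -> ~ D x ->
  exists N : V -> Prop, [/\ subspace N, forall y, D y -> N y, ~ N x &
    forall y : V, exists k : K, N (y - k *: x)].
Proof.
move=> Dsub Dx; have [D0 DP] := Dsub.
(* The condition bears on the union of D and M rather than on M, so that it
   also holds for the union of the empty chain. *)
pose P (M : V -> Prop) := subspace (fun y => D y \/ M y) /\ ~ M x.
have [F FP Ftot|M [[Msub Mx] Mmax]] := @classical_sets.Zorn_bigcup V P.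
  split; last by case=> M FM; apply: (FP _ FM).2.
  split=> [|k y z]; first by left.
  have join M y' z' : F M -> (D y' \/ M y') -> (D z' \/ M z') ->
      D (k *: y' + z') \/ classical_sets.bigcup F id (k *: y' + z').
    move=> FM y'M z'M; have [[_ Mcl] _] := FP _ FM.
    by have [Dyz|Myz] := Mcl k y' z' y'M z'M; [left | right; exists M].
  case=> [Dy|[M FM My]] [Dz|[M' FM' Mz]].
  - by left; apply: DP.
  - by apply: (join M'); [ | left | right].
  - by apply: (join M); [ | right | left].
  - have [MM'|M'M] := Ftot _ _ FM FM'.
      by apply: (join M'); [ | right; apply: MM' | right].
    by apply: (join M); [ | right | right; apply: M'M].
pose N y := D y \/ M y.
have Nx : ~ N x by case.
exists N; split=> // [y Dy|y]; first by left.
have [Ny|Ny] := EM (N y); first by exists 0; rewrite scale0r subr0.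
pose Ny' (z : V) := exists (k : K) (m : V), N m /\ z = m + k *: y.
have N'sub : subspace Ny'.
  split; first by exists 0, 0; rewrite scale0r addr0; split=> //; left.
  move=> k _ _ [a [m [Nm ->]]] [b [m' [Nm' ->]]].
  exists (k * a + b), (k *: m + m'); split; first exact: Msub.2.
  by rewrite scalerDr scalerA addrACA scalerDl.
have NN' z : N z -> Ny' z by exists 0, z; rewrite scale0r addr0.
have [[k [m [Nm xE]]]|N'x] := EM (Ny' x).
  have k0 : k != 0 by apply/eqP => k0; case: Nx; rewrite xE k0 scale0r addr0.
  exists k^-1; rewrite xE scalerDr scalerA mulVf // scale1r opprD addrCA subrr.
  by rewrite addr0 -scaleNr; apply: subspaceZ.
case: (Mmax Ny').
  split=> [z Mz|N'M]; first by apply: NN'; right.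
  case: Ny; right; apply: N'M; exists 1, 0.
  by rewrite scale1r add0r; split=> //; left.
suff E : Ny' = (fun y => D y \/ Ny' y).
  by split=> //; apply: (eq_ind _ (@subspace K V) N'sub _ E).
apply/funext => z; apply/propext; split=> [|[Dz|]] //; first by right.
by apply: NN'; left.
Qed.

(** The functional is the coordinate along x in the decomposition of the space
    into a hyperplane containing D and the line K x. *)
Lemma separating_functional (V : lmodType K) (D : V -> Prop) (x : V) :
    subspace D -> ~ D x ->
  exists f : {scalar V}, (forall y, D y -> f y = 0) /\ f x = 1.
Proof.
move=> Dsub Dx.
have [N [Nsub DN Nx Nmax]] := maximal_subspace_avoiding Dsub Dx.
have [f fP] := choice Nmax.
have fE (y : V) (k : K) : N (y - k *: x) -> f y = k.
  move=> Nk; apply/eqP; apply: contra_notT Nx; rewrite -subr_eq0 => fk.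
  have := subspaceB Nsub Nk (fP y).
  rewrite opprB [X in N X]addrC addrA subrK -scalerBl => Nfkx.
  rewrite -[x]scale1r -(mulVf fk) -scalerA; exact: subspaceZ.
have f_lin : scalar f.
  move=> k y z; apply: fE; rewrite scalerDl -scalerA opprD addrACA -scalerBr.
  exact: Nsub.2.
pose F : {scalar V} := HB.pack f (GRing.isLinear.Build K V K *%R f f_lin).
exists F; split=> [y Dy|]; apply: fE; first by rewrite scale0r subr0; apply: DN.
by rewrite scale1r subrr; apply: Nsub.1.
Qed.

Lemma scalar_ext (V : lmodType K) (x y : V) :
  (forall f : {scalar V}, f x = f y) -> x = y.
Proof.
move=> fxy; apply: contrapT => /eqP; rewrite -subr_eq0 => /eqP xy0.
have sub0 : subspace (fun z : V => z = 0).
  by split=> // k _ _ -> ->; rewrite scaler0 addr0.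
have [f [_ f1]] := separating_functional sub0 xy0.
by have := oner_neq0 K; rewrite -f1 linearB /= fxy subrr eqxx.
Qed.

Definition span (I : finType) (V : lmodType K) (v : I -> V) (y : V) : Prop :=
  exists k : I -> K, y = \sum_i k i *: v i.

Lemma subspace_span (I : finType) (V : lmodType K) (v : I -> V) : subspace (span v).
Proof.
split=> [|k _ _ [l ->] [m ->]].
  by exists (fun=> 0); rewrite big1 // => i _; rewrite scale0r.
exists (fun i => k * l i + m i); rewrite scaler_sumr -big_split.
by apply: eq_bigr => i _; rewrite scalerDl scalerA.
Qed.

Lemma mem_span (I : finType) (V : lmodType K) (v : I -> V) i : span v (v i).
Proof.
exists (fun j => (j == i)%:R); rewrite (bigD1 i) //= eqxx scale1r big1 ?addr0 //.
by move=> j /negPf->; rewrite scale0r.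
Qed.

(** Products of two functionals detect whether a tensor vanishes. Induction on
    the number of terms: if the first a_0 is a combination of the other a_i, it
    can be absorbed into them; if not, a functional equal to 1 at a_0 and to 0 at
    the other a_i forces b_0 = 0. *)
Lemma tens0_scalar (U V W : lmodType K) (F : {bilinear U -> V -> W})
    n (a : 'I_n -> U) (b : 'I_n -> V) :
    (forall (f : {scalar U}) (g : {scalar V}), \sum_i f (a i) * g (b i) = 0) ->
  \sum_i F (a i) (b i) = 0.
Proof.
elim: n a b => [|n IHn] a b fg0; first by rewrite big_ord0.
rewrite big_ord_recl /=.
have [[k aE]|aN] := EM (span (a \o lift ord0) (a ord0)).
  rewrite aE linear_sumlz -big_split /=.
  rewrite -[RHS](IHn (a \o lift ord0)
            (fun i => b (lift ord0 i) + k i *: b ord0)).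
    apply: eq_bigr => i _ /=.
    by rewrite linearDr addrC linearZl_LR linearZr_LR.
  move=> f g; rewrite -[RHS](fg0 f g) big_ord_recl aE linear_sum mulr_suml.
  rewrite -big_split; apply: eq_bigr => i _ /=.
  by rewrite !linearZ linearD linearZ mulrDr addrC /= mulrCA mulrA.
have [f [fs fa]] := separating_functional (subspace_span _) aN.
have {}fs i : f (a (lift ord0 i)) = 0 by apply: fs; apply: mem_span.
have b0 : b ord0 = 0.
  apply: scalar_ext => g; rewrite linear0 -[RHS](fg0 f g) big_ord_recl fa mul1r.
  by rewrite big1 ?addr0 // => i _; rewrite fs mul0r.
rewrite b0 linear0r add0r; apply: (IHn (a \o lift ord0) (b \o lift ord0)).
by move=> h g; rewrite -[RHS](fg0 h g) big_ord_recl b0 linear0 mulr0 add0r.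
Qed.

(** This reduces every identity between tensors below to one between products
    of scalars, hence, for matrices of elements of a coalgebra, to matrix algebra
    over K. *)
Lemma tens_eq_scalar (U V : lmodType K) (s t : seq (U * V)) :
    (forall (f : {scalar U}) (g : {scalar V}),
       \sum_(p <- s) f p.1 * g p.2 = \sum_(p <- t) f p.1 * g p.2) ->
  tens_eq s t.
Proof.
move=> fgst W F; apply/eqP; rewrite -subr_eq0 -sumrN.
pose t' := [seq (- p.1, p.2) | p <- t].
have sumE (X : zmodType) (G : U -> V -> X) : (forall u v, G (- u) v = - G u v) ->
    \sum_(i < size (s ++ t')) G (tnth (in_tuple (s ++ t')) i).1
                                (tnth (in_tuple (s ++ t')) i).2
  = \sum_(p <- s) G p.1 p.2 + \sum_(p <- t) - G p.1 p.2.
  move=> GN; rewrite -(big_tnth _ _ (s ++ t') predT (fun p => G p.1 p.2)).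
  by rewrite big_cat big_map; congr (_ + _); apply: eq_bigr => p _; apply: GN.
rewrite -sumE => [|u v]; last by rewrite linearNl.
apply/eqP; apply: tens0_scalar => f g.
rewrite (sumE _ (fun u v => f u * g v)) => [|u v]; last by rewrite linearN mulNr.
by rewrite sumrN fgst subrr.
Qed.

End Tensors.

(** * Convolution and multiplicative matrices *)

Section Rank.

Variables (K : fieldType) (V : lmodType K).
Implicit Types (phi : {scalar V} -> {scalar V} -> K).

Definition represents phi n (v b : 'I_n -> V) : Prop :=
  forall f g : {scalar V}, phi f g = \sum_i f (v i) * g (b i).

Definition minimal_rank phi n : Prop :=
  forall m (v b : 'I_m -> V), represents phi v b -> (n <= m)%N.

(** In an expression of a tensor with as few terms as possible the left factors
    are linearly independent, hence have a dual family of functionals. *)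
Lemma minimal_rank_dual phi n (v b : 'I_n -> V) :
    represents phi v b -> minimal_rank phi n ->
  exists g : 'I_n -> {scalar V}, forall i j, g i (v j) = (i == j)%:R.
Proof.
move=> vb nmin; suff ind i : ~ span (v \o lift i) (v i).
  have dual_i i : exists g : {scalar V}, forall j, g (v j) = (i == j)%:R.
    have [g [g0 g1]] := separating_functional (subspace_span _) (ind i).
    exists g => j; case: (unliftP i j) => [k ->|->]; last by rewrite eqxx.
    by rewrite (negPf (neq_lift i k)); apply: g0; apply: mem_span.
  by have [g gP] := choice dual_i; exists g.
case: n v b vb nmin i => [|n] v b vb nmin i; first by case: i.
case=> k vE.
suff /nmin : represents phi (v \o lift i) (fun j => b (lift i j) + k j *: b i).
  by rewrite ltnn.
move=> f g; rewrite vb (bigD1_ord i) //= vE linear_sum mulr_suml -big_split /=.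
by apply: eq_bigr => j _; rewrite !linearZ linearD linearZ mulrDr addrC /= mulrCA mulrA.
Qed.

End Rank.

Section Convolution.

Variables (K : fieldType) (C : lmodType K) (cC : coalgebra C).
Implicit Types (f g h : {scalar C}) (x : C).

Lemma sweedler_linear (W : lmodType K) (F : C -> C -> W) :
    (forall v, linear (F^~ v)) -> (forall u, linear (F u)) ->
  linear (fun x => \sum_(p <- comul cC x) F p.1 p.2).
Proof.
move=> Fl Fr k x y.
rewrite (tens_eq_sum Fl Fr (comul_linear cC k x y)) big_cat big_map /=.
congr (_ + _); rewrite scaler_sumr; apply: eq_bigr => p _ /=.
have F0 v : F 0 v = 0 by have := Fl v (-1) 0 0; rewrite !scaleN1r oppr0 addr0 addNr.
by have := Fl p.2 k p.1 0; rewrite F0 !addr0.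
Qed.

Definition conv f g x : K := \sum_(p <- comul cC x) f p.1 * g p.2.

Lemma conv_is_linear f g : scalar (conv f g).
Proof.
apply: (@sweedler_linear K^o (fun u v => f u * g v)) => u k v w /=.
  by rewrite linearP /= mulrDl -mulrA.
by rewrite linearP /= mulrDr mulrCA.
Qed.

HB.instance Definition _ f g :=
  GRing.isLinear.Build K C K *%R (conv f g) (conv_is_linear f g).

Lemma convA f g h x : conv (conv f g) h x = conv f (conv g h) x.
Proof.
have tri : trilinear (fun u v w => f u * g v * h w : K^o).
  split=> u v k y z; rewrite linearP /= ?mulrDr ?mulrDl.
  - by rewrite -!mulrA.
  - by rewrite (mulrCA _ k) -!mulrA.
  - by rewrite mulrCA.
have := comulA cC x tri; rewrite !big_allpairs_dep /= => E.
transitivity (\sum_(p <- comul cC x) \sum_(q <- comul cC p.1) f q.1 * g q.2 * h p.2).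
  by apply: eq_bigr => p _; rewrite mulr_suml.
rewrite E; apply: eq_bigr => p _; rewrite mulr_sumr.
by apply: eq_bigr => q _; rewrite mulrA.
Qed.

Lemma conv_counitl f x : conv (counit cC) f x = f x.
Proof.
rewrite -[in RHS](comul_counitl cC x) linear_sum.
by apply: eq_bigr => p _; rewrite linearZ.
Qed.

Lemma conv_counitr f x : conv f (counit cC) x = f x.
Proof.
rewrite -[in RHS](comul_counitr cC x) linear_sum.
by apply: eq_bigr => p _; rewrite linearZ mulrC.
Qed.

(** Stated through functionals: f |-> map_mx f c is a morphism from the dual
    algebra of the coalgebra to the matrices over K. *)
Definition multiplicative n (c : 'M[C]_n) : Prop :=
  map_mx (counit cC) c = 1%:M /\
  forall f g, map_mx (conv f g) c = map_mx f c *m map_mx g c.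

Lemma multiplicative_comul n (c : 'M[C]_n) i j : multiplicative c ->
  tens_eq (comul cC (c i j)) [seq (c i k, c k j) | k <- enum 'I_n].
Proof.
case=> _ cM; apply: tens_eq_scalar => f g.
have /matrixP/(_ i j) := cM f g; rewrite !mxE => E; rewrite [LHS]E.
by rewrite big_map big_enum; apply: eq_bigr => k _; rewrite !mxE.
Qed.

Definition coefficient_space n (c : 'M[C]_n) : C -> Prop :=
  span (fun ij : 'I_n * 'I_n => c ij.1 ij.2).

(** Every element lies in a finite-dimensional comodule. Write Delta(x) as a sum
    of v_i (x) b_i with n minimal, so that both families are linearly independent.
    By coassociativity the v_j span a comodule, Delta(v_j) being the sum of the
    v_i (x) c_ij, where c_ij is obtained by applying the j-th dual functional of
    the b's to the right factor of Delta(b_i). The same c satisfies Delta(b_i) =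
    sum of the c_ik (x) b_k, and x is the sum of the
    counit(v_i) counit(b_j) c_ij. *)
Lemma multiplicative_cover x :
  exists n (c : 'M[C]_n), multiplicative c /\ coefficient_space c x.
Proof.
pose phi f g := conv f g x.
have rep_ex : exists n, `[< exists v b : 'I_n -> C, represents phi v b >].
  exists (size (comul cC x)); apply/asboolP.
  exists (fun i => (tnth (in_tuple (comul cC x)) i).1).
  exists (fun i => (tnth (in_tuple (comul cC x)) i).2) => f g.
  by rewrite /phi /conv (big_tnth _ _ (comul cC x)).
case: (ex_minnP rep_ex) => n /asboolP[v [b vb]] nmin.
have phi_min : minimal_rank phi n.
  by move=> m v' b' vb'; apply: nmin; apply/asboolP; exists v', b'.
have bv : represents (fun f g => phi g f) b v.
  by move=> f g; rewrite vb; apply: eq_bigr => i _; rewrite mulrC.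
have phi_min' : minimal_rank (fun f g => phi g f) n.
  move=> m v' b' vb'; apply: (phi_min m b' v') => f g; rewrite vb'.
  by apply: eq_bigr => i _; rewrite mulrC.
have [gv gvP] := minimal_rank_dual vb phi_min.
have [gb gbP] := minimal_rank_dual bv phi_min'.
have vE f j : f (v j) = conv f (gb j) x.
  rewrite -/(phi _ _) vb (bigD1 j) //= gbP eqxx mulr1 big1 ?addr0 // => i /negPf ij.
  by rewrite gbP eq_sym ij mulr0.
have bE f i : f (b i) = conv (gv i) f x.
  rewrite -/(phi _ _) vb (bigD1 i) //= gvP eqxx mul1r big1 ?addr0 // => j /negPf ij.
  by rewrite gvP eq_sym ij mul0r.
have [c cE] : exists c : 'M[C]_n, forall f i j, f (c i j) = conv f (gb j) (b i).
  exists (\matrix_(i, j) \sum_(p <- comul cC (b i)) gb j p.2 *: p.1) => f i j.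
  by rewrite mxE linear_sum; apply: eq_bigr => p _; rewrite linearZ mulrC.
have vc f g j : conv f g (v j) = \sum_i f (v i) * g (c i j).
  rewrite vE convA -/(phi _ _) vb; apply: eq_bigr => i _; congr (_ * _).
  by rewrite cE.
have bc f g i : conv f g (b i) = \sum_k f (c i k) * g (b k).
  rewrite bE -convA -/(phi _ _) vb; apply: eq_bigr => k _; congr (_ * _).
  apply: etrans (vc _ _ _) _.
  rewrite (bigD1 i) //= gvP eqxx mul1r big1 ?addr0 // => j /negPf ij.
  by rewrite gvP eq_sym ij mul0r.
exists n, c; split; first split.
- by apply/matrixP => i j; rewrite !mxE cE conv_counitl gbP eq_sym.
- move=> f g; apply/matrixP => i j; rewrite !mxE.
  apply: etrans (cE _ i j) _; rewrite convA bc.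
  by apply: eq_bigr => k _; rewrite !mxE; congr (_ * _); rewrite cE.
exists (fun ij => counit cC (v ij.1) * counit cC (b ij.2)).
rewrite -(pair_bigA _ (fun i j => (counit cC (v i) * counit cC (b j)) *: c i j)).
apply: scalar_ext => f; rewrite linear_sum -conv_counitl -/(phi _ _) vb.
apply: eq_bigr => i _; rewrite linear_sum -[f (b i)](conv_counitr f) bc mulr_sumr.
by apply: eq_bigr => j _; rewrite linearZ /= mulrCA mulrC.
Qed.

End Convolution.

(** * Irreducible algebras of matrices *)

Section IrreducibleAlgebra.

Variables (K : fieldType) (n : nat).

Definition stable_under (B : 'M[K]_n -> Prop) (T : 'rV[K]_n -> Prop) : Prop :=
  subspace T /\ forall v b, T v -> B b -> T (v *m b).

Definition irreducible (B : 'M[K]_n -> Prop) : Prop :=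
  forall T, stable_under B T -> (forall v, T v -> v = 0) \/ (forall v, T v).

(** A nonzero ideal of a matrix algebra acting irreducibly on row vectors is the
    whole algebra. As in the density theorem, one builds by induction on m an
    element a of I that fixes the first m basis vectors. Let L be the right ideal
    of the elements of B that kill these vectors, and e the next basis vector.
    Then e L is 0 or everything. If it is 0, then 1 - a in L shows that a fixes e
    already. If it is everything, then so is e (L :&: I), because L I is contained
    in L :&: I and e L I = 0 would mean I = 0; so a can be corrected by an element
    of L :&: I. *)
Lemma irreducible_ideal1 (B I : 'M[K]_n -> Prop) :
    subspace B -> B 1%:M -> (forall a b, B a -> B b -> B (a *m b)) ->
    irreducible B ->
    subspace I -> (forall a, I a -> B a) ->
    (forall a b, I a -> B b -> I (a *m b)) ->
    (forall a b, B b -> I a -> I (b *m a)) ->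
    (exists2 a, I a & a != 0) ->
  I 1%:M.
Proof.
move=> Bsub B1 BM Birr Isub IB IBr IBl [a0 Ia0 a0n].
pose e (i : 'I_n) : 'rV[K]_n := delta_mx 0 i.
suff fixes m : exists2 a, I a & forall i : 'I_n, (i < m)%N -> e i *m a = e i.
  have [a Ia ae] := fixes n; suff <- : a = 1%:M by [].
  by apply/row_matrixP => i; rewrite row1 rowE ae.
elim: m => [|m [a Ia ae]]; first by exists 0 => //; exact: Isub.1.
have [mn|nm] := ltnP m n; last first.
  by exists a => // i im; apply: ae; apply: leq_trans (ltn_ord i) nm.
pose i0 := Ordinal mn.
have lt_mP (i : 'I_n) : (i < m.+1)%N -> (i < m)%N \/ i = i0.
  by rewrite ltnS leq_eqVlt => /orP[/eqP im|]; [right; exact: val_inj | left].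
pose kills (b : 'M[K]_n) := forall i : 'I_n, (i < m)%N -> e i *m b = 0.
have orbit_stable (J : 'M[K]_n -> Prop) : subspace J ->
    (forall b b', J b -> B b' -> J (b *m b')) ->
    stable_under B (fun w => exists b, [/\ J b, kills b & w = e i0 *m b]).
  move=> Jsub JB; split; first split.
  - by exists 0; split=> [|i _|]; rewrite ?mulmx0 //; exact: Jsub.1.
  - move=> k _ _ [b [Jb b0 ->]] [b' [Jb' b'0 ->]]; exists (k *: b + b').
    split=> [|i im|]; [exact: Jsub.2 | | by rewrite mulmxDr -scalemxAr].
    by rewrite mulmxDr -scalemxAr b0 // b'0 // scaler0 addr0.
  - move=> _ b' [b [Jb b0 ->]] Bb'; exists (b *m b').
    by split=> [|i im|]; [exact: JB | rewrite mulmxA b0 ?mul0mx | rewrite mulmxA].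
have [B0|BT] := Birr _ (orbit_stable B Bsub BM).
  exists a => // i /lt_mP[|->]; first exact: ae.
  apply/eqP; rewrite eq_sym -subr_eq0 -[X in X - _]mulmx1 -mulmxBr; apply/eqP.
  apply: B0; exists (1%:M - a); split=> // [|i' i'm].
    by apply: subspaceB => //; exact: IB.
  by rewrite mulmxBr mulmx1 ae // subrr.
have [I0|IT] := Birr _ (orbit_stable I Isub IBr).
  case/eqP: a0n; apply/row_matrixP => i; rewrite row0 rowE -/(e i).
  have [b [Bb b0 ->]] := BT (e i).
  apply: I0; exists (b *m a0); split; [exact: IBl | | by rewrite mulmxA].
  by move=> i' i'm; rewrite mulmxA b0 ?mul0mx.
have [b [Ib b0 bE]] := IT (e i0 - e i0 *m a).
exists (a + b) => [|i /lt_mP[im|->]]; first exact: subspaceD.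
  by rewrite mulmxDr ae // b0 // addr0.
by rewrite mulmxDr -bE addrC subrK.
Qed.

(** Take M of maximal rank among the matrices whose row space lies in T. *)
Lemma subspace_rowspace (T : 'rV[K]_n -> Prop) : subspace T ->
  exists M : 'M[K]_n, forall v, T v <-> (v <= M)%MS.
Proof.
move=> Tsub.
pose inT (M : 'M[K]_n) := forall v, (v <= M)%MS -> T v.
have rank_ex : exists r, `[< exists2 M, inT M & \rank M = r >].
  exists 0%N; apply/asboolP; exists 0; last by rewrite mxrank0.
  by move=> v; rewrite submx0 => /eqP->; exact: Tsub.1.
have rank_ub r : `[< exists2 M, inT M & \rank M = r >] -> (r <= n)%N.
  by move=> /asboolP[M _ <-]; exact: rank_leq_row.
case: (ex_maxnP rank_ex rank_ub) => r /asboolP[M MT rM] rmax.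
exists M => v; split=> [Tv|]; last exact: MT.
suff inT' : inT (M + v)%MS.
  have /rmax : `[< exists2 N, inT N & \rank N = \rank (M + v)%MS >].
    by apply/asboolP; exists (M + v)%MS.
  rewrite -rM => le_r; apply: submx_trans (addsmxSr M v) _.
  rewrite -(mxrank_leqif_sup (addsmxSl M v)).2 eqn_leq le_r andbT.
  by rewrite mxrankS ?addsmxSl.
move=> w /sub_addsmxP[[a b] /= ->].
apply: subspaceD => //; first by apply: MT; apply: submxMl.
by rewrite [b]mx11_scalar mul_scalar_mx; apply: subspaceZ.
Qed.

End IrreducibleAlgebra.

(** * Irreducible comodules of pointed coalgebras *)

Section Pointed.

Variables (K : fieldType) (C : lmodType K) (cC : coalgebra C).
Implicit Types (f g : {scalar C}) (x : C).

Definition evaluations n (c : 'M[C]_n) (P : {scalar C} -> Prop) :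
    'M[K]_n -> Prop :=
  fun b => exists2 f, P f & b = map_mx f c.

Lemma subspace_evaluations n (c : 'M[C]_n) (D : C -> Prop) :
  subspace (evaluations c (fun f => forall x, D x -> f x = 0)).
Proof.
split.
  exists (\0 : {scalar C}) => //.
  by apply/matrixP => i j; rewrite !mxE.
move=> k _ _ [f f0 ->] [g g0 ->].
have h_lin : scalar (fun x => k * f x + g x).
  by move=> l x y /=; rewrite !linearP /= !mulrDr mulrCA addrACA.
pose h : {scalar C} := HB.pack (fun x => k * f x + g x)
   (GRing.isLinear.Build K C K *%R _ h_lin).
exists h => [x Dx|]; first by rewrite /h /= f0 // g0 // mulr0 addr0.
by apply/matrixP => i j; rewrite !mxE.
Qed.

Lemma conv_subcoalgebra0 (E : C -> Prop) f g : subcoalgebra cC E ->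
    (forall x, E x -> f x = 0) \/ (forall x, E x -> g x = 0) ->
  forall x, E x -> conv cC f g x = 0.
Proof.
move=> [_ Ecoal] fg0 x Ex; have [s sE xs] := Ecoal x Ex.
rewrite /conv (tens_eq_sum (F := fun u v => f u * g v : K^o) _ _ xs).
- rewrite big_seq big1 // => p /sE[E1 E2].
  by case: fg0 => [f0|g0]; rewrite ?f0 ?g0 ?(mul0r, mulr0).
- by move=> u k v w; rewrite linearP mulrDl -mulrA.
- by move=> u k v w; rewrite linearP mulrDr mulrCA.
Qed.

Lemma linear_coefficient n (c : 'M[C]_n) (W : lmodType K) (F G : {linear C -> W}) x :
    (forall i j, F (c i j) = G (c i j)) ->
  coefficient_space c x -> F x = G x.
Proof.
move=> FG [k ->]; rewrite !linear_sum; apply: eq_bigr => ij _.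
by rewrite !linearZ FG.
Qed.

(** Let E be a subcoalgebra of the span D of the entries. The matrices f(c), for f
    in the dual of the coalgebra, form an irreducible algebra, in which those with
    f = 0 on E form an ideal. If E is not D this ideal is nonzero, so it contains
    the identity matrix: some f vanishing on E coincides on D with the counit. By
    the counit law E is then 0. *)
Lemma irreducible_simple n (c : 'M[C]_n.+1) :
    multiplicative cC c -> irreducible (evaluations c (fun=> True)) ->
  simple_subcoalgebra cC (coefficient_space c).
Proof.
move=> cmul cirr; have [c1 cM] := cmul.
have Dsub : subspace (coefficient_space c) by exact: subspace_span.
have Dc i j : coefficient_space c (c i j).
  exact: (mem_span (fun ij : 'I_n.+1 * 'I_n.+1 => c ij.1 ij.2) (i, j)).
have eps i j : counit cC (c i j) = (i == j)%:R.
  by have /matrixP/(_ i j) := c1; rewrite !mxE.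
split.
- split=> // x [k xE].
  exists [seq (k ij.1 *: c ij.1.1 ij.2, c ij.2 ij.1.2) |
            ij <- enum {: 'I_n.+1 * 'I_n.+1 * 'I_n.+1}].
    by move=> p /mapP[ij _ ->] /=; split=> //; apply: subspaceZ.
  apply: tens_eq_scalar => f g; rewrite big_map big_enum /=.
  rewrite -(pair_bigA _ (fun ij l => f (k ij *: c ij.1 l) * g (c l ij.2))) /=.
  have -> : \sum_(p <- comul cC x) f p.1 * g p.2 = conv cC f g x by [].
  rewrite xE linear_sum; apply: eq_bigr => -[i j] _; rewrite linearZ /=.
  have /matrixP/(_ i j) := cM f g; rewrite !mxE => ->; rewrite mulr_sumr.
  by apply: eq_bigr => l _; rewrite !mxE linearZ mulrA.
- exists (c ord0 ord0) => //; apply/eqP => c0; have := eps ord0 ord0.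
  by rewrite c0 linear0 => /eqP; rewrite eq_sym oner_eq0.
move=> E Ecoal ED; have [Esub Ecomul] := Ecoal.
have [DE|DE] := EM (forall i j, E (c i j)).
  right=> _ [k ->]; apply: subspace_sum => // -[i j].
  exact: subspaceZ.
left; pose B := evaluations c (fun=> True).
pose I := evaluations c (fun f => forall x, E x -> f x = 0).
have BE : B = evaluations c (fun f => forall x, False -> f x = 0).
  by apply/funext => b; apply/propext; split=> -[f _ ->]; exists f.
have [f f0 f1] : I 1%:M.
  apply: (irreducible_ideal1 (B := B)) => //.
  - by rewrite BE; exact: subspace_evaluations.
  - by exists (counit cC).
  - by move=> _ _ [f _ ->] [g _ ->]; rewrite -cM; exists (conv cC f g).
  - exact: subspace_evaluations.
  - by move=> _ [f _ ->]; exists f.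
  - move=> _ _ [f f0 ->] [g _ ->]; rewrite -cM; exists (conv cC f g) => //.
    by apply: conv_subcoalgebra0 => //; left.
  - move=> _ _ [f _ ->] [g g0 ->]; rewrite -cM; exists (conv cC f g) => //.
    by apply: conv_subcoalgebra0 => //; right.
  have /existsNP[i /existsNP[j Ecij]] := DE.
  have [f [f0 f1]] := separating_functional Esub Ecij.
  exists (map_mx f c); first by exists f.
  apply/eqP => /matrixP/(_ i j); rewrite !mxE f1 => /eqP.
  by rewrite oner_eq0.
have eps0 x : E x -> counit cC x = 0.
  move=> Ex; rewrite -(f0 x Ex); apply: (linear_coefficient (W := K^o)) (ED x Ex).
  by move=> i j; have /matrixP/(_ i j) := f1; rewrite eps !mxE => <-.
move=> x Ex; have [s sE xs] := Ecomul x Ex.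
rewrite -(comul_counitl cC x).
rewrite (tens_eq_sum (F := fun u v => counit cC u *: v) _ _ xs).
- by rewrite big_seq big1 // => p /sE[E1 _]; rewrite eps0 // scale0r.
- by move=> u k v w; rewrite linearP scalerDl -scalerA.
- by move=> u k v w; rewrite scalerDr !scalerA mulrC.
Qed.

(** The span of the entries is a line, and counit(c_ij) is the Kronecker delta,
    so c is c_00 times the identity matrix; being multiplicative, it has c_00
    grouplike. *)
Lemma pointed_irreducible n (c : 'M[C]_n) : pointed cC ->
    multiplicative cC c -> irreducible (evaluations c (fun=> True)) ->
  forall i j, exists (k : K) (x : C), grouplike cC x /\ c i j = k *: x.
Proof.
case: n c => [|n] c Cpt cmul cirr i j; first by case: i.
have [c1 cM] := cmul.
have eps i' j' : counit cC (c i' j') = (i' == j')%:R.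
  by have /matrixP/(_ i' j') := c1; rewrite !mxE.
have [d _ dP] := Cpt _ (irreducible_simple cmul cirr).
have cd i' j' : exists k : K, c i' j' = k *: d.
  apply/dP; exact: (mem_span (fun ij : 'I_n.+1 * 'I_n.+1 => c ij.1 ij.2) (i', j')).
have [k0 c00] := cd ord0 ord0.
have k0d : k0 * counit cC d = 1.
  by have := eps ord0 ord0; rewrite c00 linearZ eqxx.
have cE i' j' : c i' j' = (i' == j')%:R *: c ord0 ord0.
  have [k ck] := cd i' j'.
  have epsZ : counit cC (k *: d) = k * counit cC d by rewrite linearZ.
  rewrite -ck eps in epsZ; rewrite epsZ.
  by rewrite ck c00 scalerA -mulrA [_ * k0]mulrC k0d mulr1.
exists (i == j)%:R, (c ord0 ord0); split=> //; split.
  apply/eqP => c0; have := eps ord0 ord0; rewrite c0 linear0 => /eqP.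
  by rewrite eq_sym oner_eq0.
apply: tens_eq_scalar => f g; rewrite big_seq1 /=.
have /matrixP/(_ ord0 ord0) := cM f g; rewrite !mxE => E; apply: etrans E _.
rewrite (bigD1 ord0) //= !mxE big1 ?addr0 // => k /negPf k0'.
by rewrite !mxE (cE _ k) eq_sym k0' scale0r linear0 mul0r.
Qed.

End Pointed.

(** * Convolution quadratic maps vanishing on grouplike elements *)

Section Vanishing.

Variables (K : fieldType) (C : lmodType K) (cC : coalgebra C).
Implicit Types (f g : {scalar C}) (x : C).

Definition sandwich m n p (P : 'M[K]_(m, n)) (c : 'M[C]_(n, p)) q
    (Q : 'M[K]_(p, q)) : 'M[C]_(m, q) :=
  \matrix_(i, j) \sum_k \sum_l (P i k * Q l j) *: c k l.

Lemma matrix_scalar_ext m n (c c' : 'M[C]_(m, n)) :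
  (forall f, map_mx f c = map_mx f c') -> c = c'.
Proof.
move=> cc'; apply/matrixP => i j; apply: scalar_ext => f.
by have /matrixP/(_ i j) := cc' f; rewrite !mxE.
Qed.

Lemma map_sandwich m n p q (P : 'M[K]_(m, n)) (c : 'M[C]_(n, p))
    (Q : 'M[K]_(p, q)) f :
  map_mx f (sandwich P c Q) = P *m map_mx f c *m Q.
Proof.
apply/matrixP => i j; rewrite !mxE linear_sum.
under eq_bigr do rewrite linear_sum.
under [RHS]eq_bigr do rewrite mxE mulr_suml.
rewrite [RHS]exchange_big; apply: eq_bigr => k _; apply: eq_bigr => l _.
by rewrite linearZ mxE /= mulrAC.
Qed.

Lemma multiplicative_sandwich m n (P : 'M[K]_(m, n)) (c : 'M[C]_n)
    (Q : 'M[K]_(n, m)) : P *m Q = 1%:M -> Q *m P = 1%:M ->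
  multiplicative cC c -> multiplicative cC (sandwich P c Q).
Proof.
move=> PQ QP [c1 cM]; split; first by rewrite map_sandwich c1 mulmx1.
move=> f g; rewrite [LHS]map_sandwich !map_sandwich cM.
by rewrite !mulmxA -[_ *m Q *m P]mulmxA QP mulmx1.
Qed.

Lemma multiplicative_blocks m n (c : 'M[C]_(m + n)) : multiplicative cC c ->
    ursubmx c = 0 ->
  multiplicative cC (ulsubmx c) /\ multiplicative cC (drsubmx c).
Proof.
move=> [c1 cM] c0.
have block f : map_mx f c = block_mx (map_mx f (ulsubmx c)) 0
    (map_mx f (dlsubmx c)) (map_mx f (drsubmx c)).
  rewrite -[in LHS](submxK c) map_block_mx c0; congr block_mx.
  by apply/matrixP => i j; rewrite !mxE linear0.
have := c1; rewrite block scalar_mx_block => /eq_block_mx[ul1 _ _ dr1].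
split; split=> // f g; have := cM f g; rewrite !block mulmx_block.
  by case/eq_block_mx => -> _ _ _; rewrite mul0mx addr0.
by case/eq_block_mx => _ _ _ ->; rewrite mulmx0 add0r.
Qed.

(** The first r rows of P span a proper nonzero subspace stable under all the
    f(c), and the others span a complement; stability makes the upper right block
    of P c P^-1 vanish. *)
Lemma reducible_triangular n (c : 'M[C]_n) : multiplicative cC c ->
    ~ irreducible (evaluations c (fun=> True)) ->
  exists r s (P : 'M[K]_(r + s, n)) (Q : 'M[K]_(n, r + s)),
    [/\ (r < n)%N, (s < n)%N, P *m Q = 1%:M, Q *m P = 1%:M &
        ursubmx (sandwich P c Q) = 0].
Proof.
move=> [c1 cM] /existsNP[T /not_implyP[[Tsub Tstable] /not_orP[T0 Tall]]].
have [M TM] := subspace_rowspace Tsub.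
pose P := col_mx (row_base M) (row_base M^C%MS); pose Q := pinvmx P.
have Pfull : row_full P.
  rewrite -(eq_row_full (addsmxE _ _)).
  rewrite (eq_row_full (adds_eqmx (eq_row_base _) (eq_row_base _))).
  exact: addsmx_compl_full.
have Pfree : row_free P.
  by rewrite /row_free (eqP Pfull) mxrank_compl subnKC // rank_leq_row.
have M0 : (0 < \rank M)%N.
  rewrite lt0n mxrank_eq0; apply/eqP => M0; apply: T0 => v /TM.
  by rewrite M0 submx0 => /eqP.
have Mn : (\rank M < n)%N.
  rewrite ltn_neqAle rank_leq_col andbT; apply/negP => Mfull.
  by apply: Tall => v; apply/TM; exact: submx_full.
(* The two ranks add up to n only propositionally, so P is not typed as a square
   matrix; Q is its two-sided inverse all the same. *)
exists (\rank M), (\rank M^C%MS), P, Q; split=> //.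
- by rewrite mxrank_compl ltn_subrL M0 (leq_ltn_trans _ Mn).
- exact: mulmxVp.
- exact: mulVpmx.
apply: matrix_scalar_ext => f.
rewrite map_ursubmx map_sandwich map_mx0 mul_col_mx mul_col_mx /ursubmx col_mxKu.
have /submxP[X ->] : (row_base M *m map_mx f c <= row_base M)%MS.
  apply/row_subP => i; rewrite row_mul eq_row_base; apply/TM; apply: Tstable.
    by apply/TM; rewrite -(eq_row_base M) row_sub.
  by exists f.
rewrite -mulmxA; have -> : row_base M *m Q = row_mx 1%:M 0.
  have := mulmxVp Pfree; rewrite mul_col_mx => /(congr1 usubmx).
  by rewrite scalar_mx_block !col_mxKu.
by rewrite mul_mx_row mulmx0 row_mxKr.
Qed.

Variables (A : algType K) (d : {linear C -> A}) (w : A).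

(** The equation d * d = w d in the convolution algebra Hom(C, A). *)
Definition conv_quadratic : Prop :=
  forall x, \sum_(p <- comul cC x) d p.1 * d p.2 = w * d x.

Lemma quadratic_multiplicative n (c : 'M[C]_n) i j : conv_quadratic ->
  multiplicative cC c -> w * d (c i j) = \sum_k d (c i k) * d (c k j).
Proof.
move=> dq cmul; rewrite -dq.
rewrite (tens_eq_sum (F := fun u v => d u * d v) _ _
          (multiplicative_comul i j cmul)).
- by rewrite big_map big_enum.
- by move=> u k v z; rewrite linearP mulrDl -scalerAl.
- by move=> u k v z; rewrite linearP mulrDr -scalerAr.
Qed.

Lemma linear_sandwich0 m n p q (P : 'M[K]_(m, n)) (c : 'M[C]_(n, p))
    (Q : 'M[K]_(p, q)) :
    (forall i j, d (c i j) = 0) -> forall i j, d (sandwich P c Q i j) = 0.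
Proof.
move=> dc i j; rewrite mxE linear_sum big1 // => k _; rewrite linear_sum big1 // => l _.
by rewrite linearZ /= dc scaler0.
Qed.

(** Induction on the size of a multiplicative matrix c. In the reducible case,
    once d vanishes on the diagonal blocks of a triangular conjugate of c, each
    term of the product d(c) d(c) at a corner entry has a factor in a diagonal
    block. *)
Lemma pointed_quadratic0 : (forall a, w * a = 0 -> a = 0) ->
    pointed cC -> conv_quadratic -> (forall x, grouplike cC x -> d x = 0) ->
  forall x, d x = 0.
Proof.
move=> w_reg Cpt dq d_grp x.
suff dmul n (c : 'M[C]_n) : multiplicative cC c -> forall i j, d (c i j) = 0.
  have [n [c [/dmul dc [k ->]]]] := multiplicative_cover cC x.
  by rewrite linear_sum big1 // => ij _; rewrite linearZ /= dc scaler0.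
elim/ltn_ind: n c => n IHn c cmul.
have [cirr i j|cred] := EM (irreducible (evaluations c (fun=> True))).
  have [k [y [ygrp ->]]] := pointed_irreducible Cpt cmul cirr i j.
  by rewrite linearZ /= d_grp // scaler0.
have [r [s [P [Q [rn sn PQ QP ur0]]]]] := reducible_triangular cmul cred.
set c' := sandwich P c Q in ur0.
have c'mul : multiplicative cC c' by exact: multiplicative_sandwich.
have [/(IHn r rn) ul0 /(IHn s sn) dr0] := multiplicative_blocks c'mul ur0.
have c'ul i j : d (c' (lshift s i) (lshift s j)) = 0 by rewrite -(ul0 i j) !mxE.
have c'dr i j : d (c' (rshift r i) (rshift r j)) = 0 by rewrite -(dr0 i j) !mxE.
have c'ur i j : d (c' (lshift s i) (rshift r j)) = 0.
  by have /matrixP/(_ i j) := ur0; rewrite !mxE => ->; rewrite linear0.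
have c'0 i j : d (c' i j) = 0.
  have [i' ->|i' ->] := split_ordP i; have [j' ->|j' ->] := split_ordP j => //.
  apply: w_reg; rewrite (quadratic_multiplicative _ _ dq c'mul) big_split_ord /=.
  by rewrite !big1 ?addr0 // => k _; rewrite ?c'ul ?c'dr ?(mul0r, mulr0).
suff -> : c = sandwich Q c' P by exact: linear_sandwich0.
apply: matrix_scalar_ext => f; rewrite !map_sandwich !mulmxA QP mul1mx.
by rewrite -mulmxA QP mulmx1.
Qed.

End Vanishing.

(** * Extending invariance from grouplike elements to the Hopf algebra *)

Section CentralIdempotents.

Variable A : pzRingType.
Implicit Types (a b e : A).

Lemma reflection_squared e : e * e = e -> (1 - e *+ 2) * (1 - e *+ 2) = 1.
Proof.
move=> ee; set t := e *+ 2.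
have tt : t * t = t + t by rewrite /t mulrnAl mulrnAr ee -mulr2n.
by rewrite mulrBr mulr1 mulrBl mul1r tt opprB addrK subrK.
Qed.

(** With a, b, a', b' standing for h_1.e, h_1.1, h_2.e, h_2.1, the left-hand side
    is d(h_1) d(h_2), and each product on the right is a value h.(xy). *)
Lemma central_deviation_mul e a b a' b' : (forall a, e * a = a * e) -> e * e = e ->
  (a - b * e) * (a' - b' * e)
    = a * a' - (a * b') * e - (b * a') * e + (b * b') * e.
Proof.
move=> eC ee.
have be_a : b * e * a' = b * a' * e by rewrite -!mulrA eC.
have be_be : b * e * (b' * e) = b * b' * e.
  by rewrite -!mulrA; congr (_ * _); rewrite eC -mulrA ee.
rewrite mulrBr !mulrBl be_a be_be mulrA opprB addrA.
by rewrite addrAC (addrAC (a * a')).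
Qed.

Lemma central_deviation_scale e a b : (forall a, e * a = a * e) -> e * e = e ->
  (1 - e *+ 2) * (a - b * e) = a - a * e - a * e + b * e.
Proof.
move=> eC ee; rewrite mulrBl mul1r mulrBr !mulrnAl eC [e * (b * e)]eC -mulrA ee.
rewrite opprB !mulr2n; set p := b * e; set q := a * e.
by rewrite opprD !addrA subrK (addrAC a) (addrAC (a - q)).
Qed.

End CentralIdempotents.

Section PartialActions.

Variables (K : fieldType) (H : algType K) (hH : hopf_algebra H).
Variables (A : algType K) (act : partial_action hH A).

(** The map d(h) = h.e - (h.1) e satisfies d * d = (1 - 2e) d. The
    four terms of the expansion of d(h_1) d(h_2) come from the rule for h.(ab)
    applied to the four products of e and 1. *)
Lemma pact_invariant (e : A) : pointed hH -> central_idempotent e ->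
    (forall g, grouplike hH g -> act g e = act g 1 * e) ->
  forall h, act h e = act h 1 * e.
Proof.
move=> Hpt [eC ee] e_grp h.
have d_lin : linear (fun h => act h e - act h 1 * e).
  move=> k x y; rewrite !linearPl /= mulrDl opprD -scalerAl addrACA.
  by rewrite scalerBr.
pose d : {linear H -> A} := HB.pack (fun h => act h e - act h 1 * e)
  (GRing.isLinear.Build K H A *:%R _ d_lin).
have dE x : d x = act x e - act x 1 * e by [].
suff : d h = 0 by rewrite dE => /eqP; rewrite subr_eq0 => /eqP.
apply: (pointed_quadratic0 (w := 1 - e *+ 2)) _ Hpt _ _ h => [a wa|x|g gG].
- by rewrite -[a]mul1r -(reflection_squared ee) -mulrA wa mulr0.
- have e1 := pactM act x e e; have e2 := pactM act x e 1.
  have e3 := pactM act x 1 e; have e4 := pactM act x 1 1.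
  transitivity (act x (e * e) - act x (e * 1) * e - act x (1 * e) * e
                 + act x (1 * 1) * e).
    rewrite e1 e2 e3 e4 !mulr_suml -!sumrB -big_split /=; apply: eq_bigr => p _.
    by rewrite central_deviation_mul.
  by rewrite ee !mulr1 mul1r dE central_deviation_scale.
- by rewrite dE e_grp // subrr.
Qed.
End PartialActions.

(** * Products of central elements *)

Section CentralProducts.

Variable A : pzRingType.

Lemma prod_central_rem (I : eqType) (F : I -> A) (r : seq I) i :
    (forall i a, F i * a = a * F i) -> i \in r ->
  \prod_(j <- r) F j = F i * \prod_(j <- rem i r) F j.
Proof.
move=> FC; elim: r => // j r IHr; rewrite inE /= big_cons.
have [-> _|ij /= ir] := eqVneq i j; first by [].
by rewrite big_cons IHr // !mulrA FC.
Qed.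

(** A product indexed by a finite set follows the enumeration of the ambient
    type, which translation by a group element does not preserve; when the factors
    are central the order is immaterial. *)
Lemma perm_prod_central (I : eqType) (F : I -> A) (r s : seq I) :
    (forall i a, F i * a = a * F i) -> perm_eq r s ->
  \prod_(j <- r) F j = \prod_(j <- s) F j.
Proof.
move=> FC; elim: r s => [|i r IHr] s; first by rewrite perm_sym => /perm_nilP->.
move=> rs; have is' : i \in s by rewrite -(perm_mem rs) mem_head.
rewrite big_cons (prod_central_rem FC is'); congr (_ * _); apply: IHr.
by rewrite -(perm_cons i); apply: perm_trans rs _; exact: perm_to_rem.
Qed.

Lemma prod_central_absorb (I : finType) (F : I -> A) (X : {set I}) i :
    (forall i a, F i * a = a * F i) -> F i * F i = F i -> i \in X ->
  F i * \prod_(j in X) F j = \prod_(j in X) F j.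
Proof.
move=> FC Fi iX; rewrite -big_filter.
rewrite (prod_central_rem FC (i := i)) ?mem_filter ?iX ?mem_index_enum //.
by rewrite mulrA Fi.
Qed.

Lemma prod_central_lcoset (gT : finGroupType) (F : gT -> A) (X : {set gT}) g :
    (forall i a, F i * a = a * F i) ->
  \prod_(x in (g *: X)%g) F x = \prod_(x in X) F (g * x)%g.
Proof.
move=> FC; rewrite -big_filter -[RHS]big_filter -(big_map (fun x => g * x)%g predT F).
apply: perm_prod_central => //; apply: uniq_perm.
- by rewrite filter_uniq ?index_enum_uniq.
- by rewrite map_inj_uniq ?filter_uniq ?index_enum_uniq //; exact: mulgI.
move=> z; rewrite mem_filter mem_index_enum andbT mem_lcoset.
apply/idP/mapP => [zX|[x]].
  by exists (g^-1 * z)%g; rewrite ?mem_filter ?zX ?mem_index_enum // mulKVg.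
by rewrite mem_filter => /andP[xX _] ->; rewrite mulKg.
Qed.

End CentralProducts.

Section CentralIdempotentAlgebra.

Variables (K : fieldType) (A : algType K).
Implicit Types e f : A.

Lemma central_idempotentM e f : central_idempotent e -> central_idempotent f ->
  central_idempotent (e * f).
Proof.
move=> [eC ee] [fC ff]; split=> [a|]; first by rewrite -mulrA fC mulrA eC mulrA.
by rewrite -mulrA [f * _]mulrA -[f * e]eC -[e * f * f]mulrA ff mulrA ee.
Qed.

Lemma central_idempotent1B e : central_idempotent e -> central_idempotent (1 - e).
Proof.
move=> [eC ee]; split=> [a|]; first by rewrite mulrBl mulrBr mul1r mulr1 eC.
by rewrite mulrBl mul1r mulrBr mulr1 ee subrr subr0.
Qed.

Lemma central_idempotent_prod (I : finType) (P : pred I) (F : I -> A) :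
  (forall i, central_idempotent (F i)) -> central_idempotent (\prod_(i | P i) F i).
Proof.
move=> FI; apply: big_ind => // [|e f]; last exact: central_idempotentM.
by split=> [a|]; rewrite ?mul1r ?mulr1.
Qed.

Lemma central_idempotent_sum (I : finType) (S : {set I}) (F : I -> A) :
    (forall i, central_idempotent (F i)) ->
    (forall i j, i != j -> F i * F j = 0) ->
  central_idempotent (\sum_(i in S) F i).
Proof.
move=> FI F0; split=> [a|].
  by rewrite mulr_suml mulr_sumr; apply: eq_bigr => i _; exact: (FI i).1.
rewrite mulr_suml; apply: eq_bigr => i iS.
rewrite mulr_sumr (bigD1 i) //= (FI i).2 big1 ?addr0 // => j /andP[_ ij].
by rewrite F0 // eq_sym.
Qed.

End CentralIdempotentAlgebra.

(** * The idempotents attached to subsets of the group *)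

Section GroupPart.

Variables (K : fieldType) (H : algType K) (hH : hopf_algebra H).
Variables (A : algType K) (act : partial_action hH A).
Variables (gT : finGroupType) (u : gT -> H) (Gu : grouplike_group hH u).
Implicit Types (g x y : gT) (a b : A) (X Y Z : {set gT}).

Local Notation e g := (act (u g) 1).

Lemma comul_group (F : H -> H -> A) x :
    (forall v, linear (F^~ v)) -> (forall u, linear (F u)) ->
  \sum_(p <- comul hH (u x)) F p.1 p.2 = F (u x) (u x).
Proof.
move=> Fl Fr; have [_ /(tens_eq_sum Fl Fr) ->] : grouplike hH (u x).
  by apply/(grouplikeP Gu); exists x.
by rewrite big_seq1.
Qed.

Lemma pact_groupM g a b : act (u g) (a * b) = act (u g) a * act (u g) b.
Proof.
rewrite pactM (comul_group (F := fun v w => act v a * act w b)) //.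
- by move=> w k x y; rewrite linearPl mulrDl -scalerAl.
- by move=> w k x y; rewrite linearPl mulrDr -scalerAr.
Qed.

Lemma pact_group_l g x a : act (u g) (act (u x) a) = e g * act (u (g * x)%g) a.
Proof.
rewrite pact_pactl (comul_group (F := fun v w => act v 1 * act (w * u x) a)).
- by rewrite (grouplikeM Gu).
- by move=> w k y z; rewrite linearPl mulrDl -scalerAl.
- by move=> w k y z; rewrite mulrDl -scalerAl linearPl mulrDr -scalerAr.
Qed.

Lemma pact_group_r g x a : act (u g) (act (u x) a) = act (u (g * x)%g) a * e g.
Proof.
rewrite pact_pactr (comul_group (F := fun v w => act (v * u x) a * act w 1)).
- by rewrite (grouplikeM Gu).
- by move=> w k y z; rewrite mulrDl -scalerAl linearPl mulrDl -scalerAl.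
- by move=> w k y z; rewrite linearPl mulrDr -scalerAr.
Qed.

Lemma pact_group1 : e 1%g = 1.
Proof. by rewrite (grouplike1 Gu) pact1. Qed.

(** Centrality compares the two expressions of g.(g^-1.a), one with g.1 on the
    left and one with g.1 on the right. *)
Lemma group_unit_central_idempotent g : central_idempotent (e g).
Proof.
split=> [a|]; last by rewrite -pact_groupM mulr1.
have := pact_group_l g g^-1 a; rewrite pact_group_r mulgV.
by rewrite (grouplike1 Gu) pact1.
Qed.

Let eC g a : e g * a = a * e g. Proof. exact: (group_unit_central_idempotent g).1. Qed.
Let ee g : e g * e g = e g. Proof. exact: (group_unit_central_idempotent g).2. Qed.
Let e1C g a : (1 - e g) * a = a * (1 - e g).
Proof. exact: (central_idempotent1B (group_unit_central_idempotent g)).1. Qed.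
Let e1e1 g : (1 - e g) * (1 - e g) = 1 - e g.
Proof. exact: (central_idempotent1B (group_unit_central_idempotent g)).2. Qed.

(** Acting by g is multiplicative and sends 1 to g.1, hence the single factor g.1,
    which absorbs those produced by the F i and is still there for the empty
    product. *)
Lemma pact_group_prod g (P : pred gT) (F G : gT -> A) :
    (forall i, act (u g) (F i) = e g * G i) ->
  act (u g) (\prod_(i | P i) F i) = e g * \prod_(i | P i) G i.
Proof.
move=> FG; elim/big_rec2: _ => [|i b a _ IH]; first by rewrite mulr1.
by rewrite pact_groupM FG IH -mulrA [G i * _]mulrA -[G i * e g]eC !mulrA ee.
Qed.

Local Notation P X := (PX act u X).

Lemma PX_central_idempotent X : central_idempotent (P X).
Proof.
apply: central_idempotentM; apply: central_idempotent_prod => g.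
  exact: group_unit_central_idempotent.
exact/central_idempotent1B/group_unit_central_idempotent.
Qed.

Lemma PX_in g X : g \in X -> e g * P X = P X.
Proof.
by move=> gX; rewrite mulrA (prod_central_absorb (F := fun g => e g)).
Qed.

Lemma PX_notin g X : g \notin X -> e g * P X = 0.
Proof.
move=> gX; rewrite mulrA eC -mulrA.
rewrite -(prod_central_absorb (F := fun g => 1 - e g) (i := g)) ?inE //.
by rewrite [e g * _]mulrA mulrBr mulr1 ee subrr mul0r mulr0.
Qed.

Lemma PX_orthogonal X Y : X != Y -> P X * P Y = 0.
Proof.
move=> XY; have [g] : exists g, (g \in X) (+) (g \in Y).
  apply/existsP; apply: contraNT XY => /existsPn XY; apply/eqP/setP => g.
  by have := XY g; case: (g \in X); case: (g \in Y).
case: (boolP (g \in X)) => [gX|gX] /=.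
  by move=> gY; rewrite -(PX_in gX) eC -mulrA PX_notin ?mulr0.
by move=> gY; rewrite -(PX_in gY) mulrA -[P X * _]eC PX_notin ?mul0r.
Qed.

(** One of the factors is 1 - 1.1 = 0. *)
Lemma PX0 X : 1%g \notin X -> P X = 0.
Proof. by move=> X1; rewrite -[LHS]mul1r -pact_group1 PX_notin. Qed.

Lemma pact_PX g X : act (u g) (P X) = e g * P (g *: X)%g.
Proof.
rewrite pact_groupM.
rewrite (pact_group_prod _ (G := fun x => e (g * x)%g)); last first.
  by move=> x; rewrite pact_group_l.
rewrite (pact_group_prod _ (G := fun x => 1 - e (g * x)%g)); last first.
  by move=> x; rewrite linearBr pact_group_l mulrBr mulr1.
rewrite /PX (prod_central_lcoset (F := fun x => e x)) //.
have -> : ~: (g *: X)%g = (g *: ~: X)%g.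
  by apply/setP => x; rewrite !(inE, mem_lcoset).
rewrite (prod_central_lcoset (F := fun x => 1 - e x)) //.
by rewrite -mulrA [_ * (e g * _)]mulrA -[_ * e g]eC !mulrA ee.
Qed.

(** As 1 is in X, g is in gX and g.1 is already a factor of P_{gX}. *)
Lemma pact_PX1 g X : 1%g \in X -> act (u g) (P X) = P (g *: X)%g.
Proof. by move=> X1; rewrite pact_PX PX_in // mem_lcoset mulVg. Qed.

Lemma sum_pact_PX X : 1%g \in X ->
  \sum_g act (u g) (P X) = \sum_(g | g^-1%g \in X) P (g *: X)%g.
Proof.
move=> X1; rewrite [RHS]big_mkcond; apply: eq_bigr => g _; rewrite pact_PX1 //.
by case: ifPn => // gX; rewrite PX0 // mem_lcoset mulg1.
Qed.

Local Notation GT X := (GammaT act u X).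

Lemma GammaT_central_idempotent X : central_idempotent (GT X).
Proof.
by apply: central_idempotent_sum; [exact: PX_central_idempotent | exact: PX_orthogonal].
Qed.

(** The translates gX with g^-1 not in X miss 1 and contribute nothing, so the sum
    may be taken over a whole orbit, on which G acts by permutations. *)
Lemma GammaT_orbit X : GT X = \sum_(Y in [set (g *: X)%g | g : gT]) P Y.
Proof.
rewrite /GammaT big_mkcond [RHS]big_mkcond; apply: eq_bigr => Y _.
case: imsetP => [[g gX ->]|nY]; first by rewrite ifT //; apply/imsetP; exists g.
case: imsetP => // -[g _ YE]; rewrite PX0 //; apply/negP => Y1.
by case: nY; exists g => //; move: Y1; rewrite YE inE mem_lcoset mulg1.
Qed.

Lemma GammaT_group_invariant g X : act (u g) (GT X) = e g * GT X.
Proof.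
have translate_inj : injective (fun Y : {set gT} => (g *: Y)%g).
  exact: can_inj (lcosetK g).
rewrite GammaT_orbit linear_sumr mulr_sumr [RHS](reindex_inj translate_inj).
apply: eq_big => Y; last by rewrite pact_PX.
apply/imsetP/imsetP => -[h _ YE].
  by exists (g * h)%g => //; rewrite YE lcosetM.
exists (g^-1 * h)%g => //; rewrite lcosetM -YE -lcosetM mulVg lcoset1 //.
Qed.

(** For h^-1 in X, the elements g with gX = hX form the left coset of h modulo
    GX X, and all of them satisfy g^-1 in X, because this means that 1 is in gX. *)
Lemma GammaT_mulrn X : 1%g \in X ->
  GT X *+ #|GX X| = \sum_g act (u g) (P X).
Proof.
move=> X1; rewrite sum_pact_PX // /GammaT -sumrMnl.
rewrite (partition_big (fun g => (g *: X)%g)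
  (mem [set (g *: X)%g | g : gT & g^-1%g \in X])) /=; last first.
  by move=> g gX; apply/imsetP; exists g; rewrite ?inE.
apply: eq_bigr => _ /imsetP[h hX ->]; rewrite inE in hX.
rewrite (eq_bigr (fun=> P (h *: X)%g)) => [|g /andP[_ /eqP->]] //.
rewrite sumr_const; congr (_ *+ _).
rewrite -(card_lcoset _ h); apply: eq_card => g.
have inv_mem k Y : (k^-1%g \in Y) = (1%g \in (k *: Y)%g) by rewrite mem_lcoset mulg1.
rewrite mem_lcoset inE [RHS]unfold_in /= !inv_mem lcosetM.
have -> : (h^-1 *: (g *: X) == X)%g = (g *: X == h *: X)%g.
  by apply/eqP/eqP => [{2}<-|->]; rewrite ?lcosetKV ?lcosetK.
by case: eqP => [->|_]; rewrite ?andbF // lcosetK X1 -inv_mem hX.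
Qed.

(** The scalar is 1 or 0 according to whether #|GX X| is nonzero in K. *)
Lemma Gamma_GammaT X : 1%g \in X ->
  Gamma act u X = (#|GX X|%:R^-1 * #|GX X|%:R) *: GT X.
Proof. by move=> X1; rewrite /Gamma -GammaT_mulrn // -scaler_nat scalerA. Qed.

End GroupPart.

Theorem lemma2p7 (K : fieldType) (H : algType K) (hH : hopf_algebra H)
    (H_pointed : pointed hH) (antipode_inv : bijective (antipode hH))
    (gT : finGroupType) (u : gT -> H) (Gu : grouplike_group hH u)
    (A : algType K) (act : partial_action hH A)
    (X : {set gT}) (X1 : 1%g \in X) :
  [/\ Gamma act u X =
        #|GX X|%:R^-1 *: \sum_(g : gT | g^-1%g \in X) PX act u (g *: X)%g,
      central_idempotent (Gamma act u X) &
      forall h : H, act h (Gamma act u X) = act h 1 * Gamma act u X]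
  /\
  [/\ GammaT act u X *+ #|GX X| = \sum_(g : gT) act (u g) (PX act u X),
      central_idempotent (GammaT act u X) &
      forall h : H, act h (GammaT act u X) = act h 1 * GammaT act u X].
Proof.
have GTci := GammaT_central_idempotent act Gu X.
have GTinv h : act h (GammaT act u X) = act h 1 * GammaT act u X.
  apply: pact_invariant => // x /(grouplikeP Gu)[g <-].
  exact: GammaT_group_invariant.
split; split=> //; last exact: GammaT_mulrn.
  by rewrite /Gamma (sum_pact_PX act Gu).
all: rewrite (Gamma_GammaT act Gu X1).
all: have [->|m0] := eqVneq (#|GX X|%:R : K) 0; first rewrite mulr0 scale0r.
- by split=> [a|]; rewrite ?mulr0 ?mul0r.
- by rewrite mulVf // scale1r.
- by move=> h; rewrite linear0r mulr0.
- by move=> h; rewrite mulVf // scale1r.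
Qed.
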